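(* Let $G$ be a distance-regular graph with classical parameters with $b\geq 1$ of diameter $d$. Let $w_0(\theta_1),w_1(\theta_1),\ldots,w_d(\theta_1)$ denote the cosine sequence of $\theta_1$. Then \[ \min_{1\leq r\leq d}\left\{ \frac{1-w_r(\theta_1)}{r^2}\right\} = \frac{1-w_d(\theta_1)}{d^2}. \]
   Context: A distance-regular graph of diameter $d$ with valency $k$ and intersection numbers $b_i, c_i$ (and $a_i=k-b_i-c_i$) has eigenvalues $\theta_0>\theta_1>\ldots>\theta_d$; for an eigenvalue $\theta$ the cosine sequence is determined by $w_0(\theta)=1$, $w_1(\theta)=\theta/k$ and $\theta w_r(\theta) = c_r w_{r-1}(\theta)+a_r w_r(\theta)+b_r w_{r+1}(\theta)$. For integers $b\neq 0,-1$, the Gaussian coefficient $\left[{n \atop m}\right]_b$ equals $0$ if $m<0$, $\binom{n}{m}$ if $b=1$, and $\prod_{h=0}^{m-1}\frac{b^{n-h}-1}{b^{m-h}-1}$ otherwise. A distance-regular graph has classical parameters $(d,b,\alpha,\beta)$ if $b_i = (\left[{d \atop 1}\right]_b-\left[{i \atop 1}\right]_b)(\beta - \alpha \left[{i \atop 1}\right]_b)$ and $c_i = \left[{i \atop 1}\right]_b(1+\alpha\left[{i-1 \atop 1}\right]_b)$ for $0\le i\le d$. *)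

(* Defs.v *)
From HB Require Import structures.
From mathcomp Require Import all_boot all_order all_algebra.

Set Implicit Arguments.
Unset Strict Implicit.
Unset Printing Implicit Defensive.

Import Order.TTheory GRing.Theory Num.Theory.
Local Open Scope ring_scope.

Section Graphs.
Variables (T : finType) (e : rel T).

Definition walk (n : nat) (x y : T) : bool :=
  [exists p : n.-tuple T, path e x p && (last x p == y)].

(* In a connected graph a shortest walk has fewer than #|T| edges, so the
   search always succeeds; the value is #|T| when no walk exists. *)
Definition gdist (x y : T) : nat := find (fun n => walk n x y) (iota 0 #|T|).

Definition diameter : nat := (\max_(x : T) \max_(y : T) gdist x y)%N.

(* Only the values bs i and cs i with i <= d are constrained. *)
Record distance_regular (d k : nat) (bs cs : nat -> nat) : Prop := {
  drg_sym : symmetric e;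
  drg_irr : irreflexive e;
  drg_connected : forall x y, connect e x y;
  drg_diameter : diameter = d;
  drg_valency : forall x, #|[set z | e x z]| = k;
  drg_b : forall x y,
    #|[set z | e y z & gdist x z == (gdist x y).+1]| = bs (gdist x y);
  drg_c : forall x y,
    #|[set z | e y z & (gdist x z).+1 == gdist x y]| = cs (gdist x y)
}.

Definition adjacency_mx (R : nzRingType) : 'M[R]_#|T| :=
  \matrix_(i, j) (e (enum_val i) (enum_val j))%:R.

(* theta`_0 > theta`_1 > ... is the list of all distinct eigenvalues. *)
Definition eigenvalue_list (R : rcfType) (theta : seq R) : Prop :=
  sorted (fun x y => x > y) theta /\
  forall x, (x \in theta) = eigenvalue (adjacency_mx R) x.

End Graphs.

Section ClassicalParameters.
Variable R : rcfType.

(* Extended to negative n by 'C(-k, m) = (-1)^m 'C(k + m - 1, m). *)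
Definition binz (n : int) (m : nat) : R :=
  match n with
  | Posz n => 'C(n, m)%:R
  | Negz n => (-1) ^+ m * 'C((n + m)%N, m)%:R
  end.

Definition gauss (b n m : int) : R :=
  match m with
  | Posz m =>
      if b == 1 then binz n m
      else \prod_(h < m)
             ((b%:~R ^ (n - h%:Z) - 1) / (b%:~R ^ (m%:Z - h%:Z) - 1))
  | Negz _ => 0
  end.

Definition classical_parameters (bs cs : nat -> nat)
    (d : nat) (b : int) (alpha beta : R) : Prop :=
  forall i : nat, (i <= d)%N ->
    (bs i)%:R = (gauss b d 1 - gauss b i 1) * (beta - alpha * gauss b i 1) /\
    (cs i)%:R = gauss b i 1 * (1 + alpha * gauss b (i%:Z - 1) 1).

(* The equations for 0 < r < d already determine w 0, ..., w d. *)
Definition cosine_sequence (d k : nat) (bs cs : nat -> nat)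
    (theta : R) (w : nat -> R) : Prop :=
  let a r : R := k%:R - (bs r)%:R - (cs r)%:R in
  [/\ w 0%N = 1,
      w 1%N = theta / k%:R
    & forall r : nat, (0 < r < d)%N ->
        theta * w r = (cs r)%:R * w r.-1 + a r * w r + (bs r)%:R * w r.+1].

(* Minimum of F m, ..., F n, for m <= n: the default F m is itself one of the
   values. *)
Definition min_range (m n : nat) (F : nat -> R) : R :=
  \big[Num.min/F m]_(m <= r < n.+1) F r.

End ClassicalParameters.

(* Main.v *)
(** For classical parameters with b >= 1 the second largest eigenvalue is
    theta_1 = b_1 / b - 1, with cosine sequence
      w_r = 1 - (1 - theta_1 / k) * (1 + b^-1 + ... + b^-(r-1)).
    The recurrence holds for all 0 <= r <= d, so w composed with the distance
    from a vertex is an eigenvector.  As w is strictly decreasing, a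
    Perron-Frobenius argument on its differences shows that no eigenvalue lies
    strictly between theta_1 and k.  Finally the partial sums of the decreasing
    sequence b^-j have nonincreasing averages, so dividing them by r^2 gives a
    nonincreasing sequence, whose minimum is at r = d. *)

Require Import Defs.
From HB Require Import structures.
From mathcomp Require Import all_boot all_order all_algebra.
From mathcomp Require Import ring lra zify.

Set Implicit Arguments.
Unset Strict Implicit.
Unset Printing Implicit Defensive.

Import Order.TTheory GRing.Theory Num.Theory.
Local Open Scope ring_scope.

(** * Sorted lists and averages of geometric sums *)

Lemma second_of_sorted (R : rcfType) (s : seq R) (x y : R) :
    sorted (fun u v => u > v) s -> x \in s -> y \in s -> y < x ->
    (forall z, z \in s -> z != x -> z <= y) ->
  s`_1 = y.
Proof.
have gt_trans : transitive (fun u v : R => u > v).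
  by move=> v u t uv vt; exact: lt_trans vt uv.
case: s => // x0 s /= srt xs ys yx max_y.
have /allP lt_x0 := order_path_min gt_trans srt.
have x0E : x0 = x.
  (* A head other than [x] would be at most [y < x], yet it would exceed the later member [x]. *)
  apply: contraTeq xs => x0x; rewrite inE eq_sym (negbTE x0x) /=.
  apply/negP => /lt_x0 x_lt; have := max_y x0 (mem_head _ _) x0x.
  by rewrite leNgt (lt_trans yx x_lt).
rewrite inE x0E (lt_eqF yx) /= in ys.
case: s srt ys lt_x0 {xs} max_y => // x1 s /= /andP[_ srt] ys lt_x0 max_y.
have /allP lt_x1 := order_path_min gt_trans srt.
apply/eqP; rewrite eq_le max_y ?inE ?eqxx ?orbT //=; last first.
  by rewrite -x0E lt_eqF // lt_x0 ?mem_head.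
by move: ys; rewrite inE => /predU1P[->|/lt_x1/ltW].
Qed.

(** It suffices to pass from [p] to [p + 1]. The term [q ^+ p] is at most each of the [p] terms of
    [S], so [p^2 q^p <= p S <= (2p + 1) S], which is the cross-multiplied inequality. *)
Lemma geometric_sum_div_sqr (R : rcfType) (q : R) (m n : nat) :
    0 < q -> q <= 1 -> (0 < m <= n)%N ->
  (\sum_(j < n) q ^+ j) / n%:R ^+ 2 <= (\sum_(j < m) q ^+ j) / m%:R ^+ 2.
Proof.
move=> q0 q1 /andP[m0 le_mn]; rewrite -(subnK le_mn).
elim: (n - m)%N => // i; apply: le_trans; rewrite addSn.
set p := (i + m)%N; have p0 : 0 < p%:R :> R by rewrite ltr0n /p; lia.
have p1 : 0 < p.+1%:R :> R by rewrite ltr0n.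
set S := \sum_(j < p) q ^+ j.
have S0 : 0 <= S by apply: sumr_ge0 => j _; rewrite exprn_ge0 // ltW.
have avg : p%:R * q ^+ p <= S.
  rewrite mulr_natl -[p in _ *+ p]card_ord -sumr_const; apply: ler_sum => j _.
  by apply: ler_wiXn2l; [exact: ltW | exact: q1 | exact: ltnW].
rewrite big_ord_recr /= -/S ler_pdivrMr ?exprn_gt0 // mulrAC ler_pdivlMr ?exprn_gt0 //.
have -> : p.+1%:R = p%:R + 1 :> R by rewrite -natr1.
set P : R := p%:R in p0 avg *.
have := ler_wpM2l (ltW p0) avg; have := mulr_ge0 (ltW p0) S0; nra.
Qed.

(** * Distance in a connected graph *)

Section Distance.
Variables (T : finType) (e : rel T).

Lemma walkP (n : nat) (x y : T) :
  reflect (exists p, [/\ path e x p, last x p = y & size p = n])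
          (walk e n x y).
Proof.
apply: (iffP existsP) => [[p /andP[ep /eqP lp]]|[p [ep lp sp]]].
  by exists p; rewrite size_tuple.
have sp' : size p == n by apply/eqP.
by exists (Tuple sp'); rewrite /= ep lp /=.
Qed.

Lemma walk0 (x y : T) : walk e 0 x y = (x == y).
Proof.
apply/walkP/eqP => [[[|? ?] [//]]|<-]; by exists [::].
Qed.

Lemma walkS (n : nat) (x y : T) :
  reflect (exists2 z, walk e n x z & e z y) (walk e n.+1 x y).
Proof.
apply: (iffP (walkP _ _ _)) => [[p]|[z /walkP[p [ep lp sp]] ezy]].
  case/lastP: p => [[]//|p z]; rewrite rcons_path last_rcons size_rcons.
  by case=> /andP[ep ez] <- [sp]; exists (last x p) => //; apply/walkP; exists p.
by exists (rcons p y); rewrite rcons_path last_rcons size_rcons lp sp ep.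
Qed.

Hypothesis econn : forall x y, connect e x y.

Lemma has_walk (x y : T) : has (fun n => walk e n x y) (iota 0 #|T|).
Proof.
have /connectP[p ep ->] := econn x y.
case/shortenP: ep => q eq uq _.
apply/hasP; exists (size q); last by apply/walkP; exists q.
by rewrite mem_iota /= add0n -[(size q).+1]/(size (x :: q)) -(card_uniqP uq) max_card.
Qed.

Lemma gdist_walk (x y : T) : walk e (gdist e x y) x y.
Proof.
have := nth_find 0%N (has_walk x y); rewrite nth_iota //.
by have := has_walk x y; rewrite has_find size_iota.
Qed.

Lemma gdist_le (n : nat) (x y : T) : walk e n x y -> (gdist e x y <= n)%N.
Proof.
move=> wn; rewrite leqNgt; apply/negP => lt_n.
have := before_find 0%N lt_n.
rewrite nth_iota ?add0n ?wn //.
have := has_walk x y; rewrite has_find size_iota; exact: ltn_trans.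
Qed.

Lemma gdist_eq0 (x y : T) : (gdist e x y == 0%N) = (x == y).
Proof.
apply/idP/idP => [/eqP d0|]; first by have := gdist_walk x y; rewrite d0 walk0.
by rewrite -walk0 => /gdist_le; rewrite leqn0.
Qed.

Lemma gdist_adj (x y z : T) : e y z -> (gdist e x z <= (gdist e x y).+1)%N.
Proof. by move=> eyz; apply/gdist_le/walkS; exists y => //; apply: gdist_walk. Qed.

Lemma gdist_pred (n : nat) (x y : T) : gdist e x y = n.+1 ->
  exists2 z, e z y & gdist e x z = n.
Proof.
move=> dxy; have := gdist_walk x y; rewrite dxy => /walkS[z wz ezy].
exists z => //; have := gdist_le wz; have := gdist_adj x ezy; lia.
Qed.

Lemma gdist_le_diameter (x y : T) : (gdist e x y <= diameter e)%N.
Proof.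
apply: leq_trans (leq_bigmax (F := fun x => \max_y gdist e x y)%N x).
exact: (leq_bigmax (F := gdist e x) y).
Qed.

Lemma diameter_gdist : (0 < diameter e)%N ->
  exists x y, gdist e x y = diameter e.
Proof.
case: (posnP #|T|) => [T0|Tpos].
  by rewrite /diameter big_pred0 // => x; have := fintype0 x; rewrite T0.
have [x dx] := bigop.eq_bigmax (fun x => \max_y gdist e x y)%N Tpos.
have [y dy] := bigop.eq_bigmax (gdist e x) Tpos.
by exists x, y; rewrite /diameter dx dy.
Qed.

(** Start from a pair realizing the diameter and move the endpoint back along a shortest walk, one
    step at a time. *)
Lemma exists_gdist (n : nat) : (0 < diameter e)%N -> (n <= diameter e)%N ->
  exists x y, gdist e x y = n.
Proof.
move=> /diameter_gdist[x [y dxy]] le_n.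
rewrite -(subKn le_n); elim: (diameter e - n)%N => [|m [u [v IH]]].
  by exists x, y; rewrite subn0.
case E : (gdist e u v) => [|p]; first by exists u, v; lia.
by have [z _ dz] := gdist_pred E; exists u, z; lia.
Qed.

End Distance.

(** * Eigenvalues of distance-regular graphs *)

Section DistanceRegular.
Variables (R : rcfType) (T : finType) (e : rel T).
Variables (d k : nat) (bs cs : nat -> nat).
Hypothesis hG : distance_regular e d k bs cs.

Local Notation dist := (gdist e).
Let econn := drg_connected hG.
Let esym := drg_sym hG.

Lemma sum_neighbors_const (z : T) (c : R) : \sum_(y | e z y) c = k%:R * c.
Proof.
rewrite sumr_const -(drg_valency hG z) mulr_natl; congr (_ *+ _).
by apply: eq_card => y; rewrite !inE.
Qed.

(** A neighbour of [z] lies at distance [r - 1], [r] or [r + 1] from [x]. Writing the sum as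
    [k * phi r] plus increments avoids the number [a_r], and at [r = 0] the second increment
    vanishes. *)
Lemma sum_neighbors_radial (phi : nat -> R) (x z : T) :
  let r := dist x z in
  \sum_(y | e z y) phi (dist x y) =
    k%:R * phi r + (bs r)%:R * (phi r.+1 - phi r)
                 + (cs r)%:R * (phi r.-1 - phi r).
Proof.
move=> r; rewrite -(drg_b hG) -(drg_c hG) -(sum_neighbors_const z).
rewrite !mulr_natl -!sumr_const.
under [X in _ + X + _]eq_bigl do rewrite inE.
under [X in _ + X]eq_bigl do rewrite inE.
rewrite !big_mkcondr /= -!big_split /=; apply: eq_bigr => y ezy.
have := gdist_adj econn x ezy; rewrite esym in ezy.
have := gdist_adj econn x ezy; rewrite -/r => l1 l2.
case: eqP => [E1|N1]; case: eqP => [E2|N2]; rewrite ?addr0.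
- lia.
- by rewrite E1; ring.
- by rewrite -E2 /=; ring.
- by have -> : dist x y = r by lia.
Qed.

Lemma eigenvalue_adjacencyP (mu : R) :
  reflect (exists f : T -> R, (exists x, f x != 0) /\
             forall y, \sum_(z | e y z) f z = mu * f y)
          (eigenvalue (adjacency_mx e R) mu).
Proof.
apply: (iffP eigenvalueP) => [[v vA v0]|[f [[x fx] fA]]].
  exists (fun y => v 0 (enum_rank y)); split.
    by have /rV0Pn[i vi] := v0; exists (enum_val i); rewrite enum_valK.
  move=> y; have /rowP/(_ (enum_rank y)) := vA; rewrite !mxE => <-.
  rewrite (reindex_onto enum_rank enum_val) /=; last by move=> i _; exact: enum_valK.
  rewrite big_mkcond [RHS]big_mkcond; apply: eq_bigr => z _.
  by rewrite enum_rankK eqxx mxE !enum_rankK esym; case: (e z y); rewrite ?mulr1 ?mulr0.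
exists (\row_i f (enum_val i)).
  apply/rowP => i; rewrite !mxE -fA.
  rewrite (reindex_onto enum_rank enum_val) /=; last by move=> j _; exact: enum_valK.
  rewrite big_mkcond [RHS]big_mkcond; apply: eq_bigr => z _.
  rewrite enum_rankK eqxx !mxE !enum_rankK esym.
  by case: (e _ z); rewrite ?mulr1 ?mulr0.
by apply/rV0Pn; exists (enum_rank x); rewrite mxE enum_rankK.
Qed.

Lemma valency_gt0 : (0 < d)%N -> (0 < k)%N.
Proof.
rewrite -(drg_diameter hG) => d0; have [x [y dxy]] := exists_gdist econn d0 d0.
have [z ezy _] := gdist_pred econn dxy.
by rewrite -(drg_valency hG z) card_gt0; apply/set0Pn; exists y; rewrite inE.
Qed.

Lemma b_gt0 (r : nat) : (r < d)%N -> (0 < bs r)%N.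
Proof.
rewrite -(drg_diameter hG) => rd; have [|x [y dxy]] := exists_gdist econn _ rd.
  by lia.
have [z ezy dz] := gdist_pred econn dxy.
by rewrite -dz -(drg_b hG) card_gt0; apply/set0Pn; exists y; rewrite inE ezy dxy dz eqxx.
Qed.

Lemma b_le_valency (r : nat) : (0 < d)%N -> (r <= d)%N -> (bs r <= k)%N.
Proof.
rewrite -(drg_diameter hG) => d0 /(exists_gdist econn d0)[x [y <-]].
rewrite -(drg_b hG) -(drg_valency hG y); apply: subset_leq_card.
by apply/subsetP => z; rewrite !inE => /andP[].
Qed.

Lemma b_0 : (0 < d)%N -> bs 0 = k.
Proof.
rewrite -(drg_diameter hG) => d0; have [x _] := exists_gdist econn d0 (leq0n _).
have dxx : dist x x = 0%N by apply/eqP; rewrite gdist_eq0.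
have := drg_b hG x x; rewrite dxx => <-; rewrite -(drg_valency hG x).
apply: eq_card => z; rewrite !inE; case exz: (e x z) => //=.
have := gdist_adj econn x exz; rewrite dxx.
have : dist x z != 0%N.
  by rewrite gdist_eq0 //; apply: contraTneq exz => <-; rewrite (drg_irr hG).
by move=> *; apply/eqP; lia.
Qed.

(** Sum the eigenvalue equation over the ball of radius [r]: each [f z] is weighted by the number of
    neighbours of [z] in the ball. This is [k] in the interior, [k - bs r] on the sphere of radius
    [r], [cs r.+1] on the next sphere and 0 beyond. *)
Lemma ball_sum_recurrence (mu : R) (f : T -> R) (x : T) :
    (forall y, \sum_(z | e y z) f z = mu * f y) ->
  let G r := \sum_(y | (dist x y < r)%N) f y in
  forall r, (mu - k%:R) * G r.+1 =
    (cs r.+1)%:R * (G r.+2 - G r.+1) - (bs r)%:R * (G r.+1 - G r).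
Proof.
move=> fA G r.
have sphere n : G n.+1 - G n = \sum_(y | dist x y == n) f y.
  apply/eqP; rewrite subr_eq /G; apply/eqP.
  rewrite (bigID (fun y => dist x y == n)) /=; congr (_ + _).
    by apply: eq_bigl => y; lia.
  by apply: eq_bigl => y; lia.
rewrite !sphere mulrBl.
have -> : mu * G r.+1 = \sum_z f z * \sum_(y | e z y) (dist x y < r.+1)%:R.
  rewrite /G mulr_sumr.
  under eq_bigr do rewrite -fA.
  rewrite big_mkcond /=.
  under [RHS]eq_bigr do rewrite mulr_sumr big_mkcond /=.
  rewrite exchange_big /=; apply: eq_bigr => y _.
  case: ifP => _; last by rewrite big1 // => z _; case: ifP; rewrite ?mulr0.
  by rewrite big_mkcond; apply: eq_bigr => z _; rewrite esym mulr1.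
(* The number of neighbours in the ball is the neighbour sum of a radial indicator. *)
under eq_bigr do rewrite (sum_neighbors_radial (fun n => (n < r.+1)%:R)).
rewrite /G !mulr_sumr [X in _ - X]big_mkcond [X in _ = X - _]big_mkcond.
rewrite [X in _ = _ - X]big_mkcond -!sumrB; apply: eq_bigr => z _ /=.
have [lt_zr|lt_rz|->] := ssrnat.ltngtP (dist x z) r.
- have [-> -> ->] : [/\ (dist x z < r.+1)%N, ((dist x z).-1 < r.+1)%N
    & dist x z == r.+1 = false] by split; lia.
  by rewrite ltnS lt_zr /=; ring.
- have -> : (dist x z < r.+1)%N = false by lia.
  rewrite ltnS [(dist x z < r)%N]ltnNge ltnW //=.
  have [->|ne] := eqVneq (dist x z) r.+1; first by rewrite ltnSn /=; ring.
  have -> : ((dist x z).-1 < r.+1)%N = false; [lia|rewrite /=; ring].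
- have [-> ->] : (r.-1 < r.+1)%N /\ r == r.+1 = false by split; lia.
  by rewrite ltnSn ltnn /=; ring.
Qed.

(** The ball of radius [d] is the whole graph, and an eigenvector for [mu != k] is orthogonal to the
    constants. *)
Lemma ball_sum_full (mu : R) (f : T -> R) (x : T) :
    (forall y, \sum_(z | e y z) f z = mu * f y) -> mu != k%:R ->
  \sum_(y | (dist x y < d.+1)%N) f y = 0.
Proof.
move=> fA muk.
rewrite (eq_bigl xpredT); last first.
  by move=> y; rewrite ltnS -(drg_diameter hG) gdist_le_diameter.
have : (mu - k%:R) * \sum_y f y = 0.
  rewrite mulrBl !mulr_sumr -(eq_bigr _ (fun y _ => fA y)).
  under eq_bigr do rewrite big_mkcond.
  rewrite exchange_big -sumrB big1 // => z _ /=.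
  under eq_bigr do rewrite esym.
  by rewrite -big_mkcond sum_neighbors_const subrr.
by move/eqP; rewrite mulf_eq0 subr_eq0 (negbTE muk) /= => /eqP.
Qed.

Lemma eigenvalue_valency : (0 < d)%N -> eigenvalue (adjacency_mx e R) k%:R.
Proof.
rewrite -(drg_diameter hG) => d0; have [x _] := exists_gdist econn d0 (leq0n _).
apply/eigenvalue_adjacencyP; exists (fun=> 1); split; first by exists x; exact: oner_neq0.
by move=> y; rewrite sum_neighbors_const.
Qed.

Lemma eigenvalue_radial (phi : nat -> R) (th : R) : (0 < d)%N ->
    phi 0%N != 0 ->
    (forall r, (r <= d)%N -> (bs r)%:R * (phi r.+1 - phi r)
       + (cs r)%:R * (phi r.-1 - phi r) = (th - k%:R) * phi r) ->
  eigenvalue (adjacency_mx e R) th.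
Proof.
move=> d0 phi0 phiE; have d0' := d0; rewrite -(drg_diameter hG) in d0'.
have [x _] := exists_gdist econn d0' (leq0n _).
apply/eigenvalue_adjacencyP; exists (fun y => phi (dist x y)); split.
  by exists x; have /eqP-> : dist x x == 0%N by rewrite gdist_eq0.
move=> y; rewrite sum_neighbors_radial -addrA phiE; first by ring.
by rewrite -(drg_diameter hG) gdist_le_diameter.
Qed.

(* The differences [D] of the cosine sequence of [th] form a positive right
   eigenvector of a tridiagonal matrix with nonnegative off-diagonal entries,
   of which the ball sums of any nonconstant eigenvector form a left
   eigenvector; pairing their absolute values with [D] gives the bound, as in
   Perron-Frobenius. *)
Lemma eigenvalue_le (D : nat -> R) (th mu : R) : (0 < d)%N ->
    (forall r, 0 < D r) -> bs d = 0%N -> cs 0 = 0%N ->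
    (forall r, (r < d)%N -> (bs r.+1)%:R * D r.+1 + (cs r)%:R * D r.-1
       - ((bs r)%:R + (cs r.+1)%:R) * D r = (th - k%:R) * D r) ->
  eigenvalue (adjacency_mx e R) mu -> mu != k%:R -> mu <= th.
Proof.
move=> d0 D0 bd c0 DE /eigenvalue_adjacencyP[f [[x fx] fA]] muk.
pose G r := \sum_(y | (dist x y < r)%N) f y.
have GE r : (mu - k%:R) * G r.+1 =
    (cs r.+1)%:R * (G r.+2 - G r.+1) - (bs r)%:R * (G r.+1 - G r).
  exact: ball_sum_recurrence.
have Gd : G d.+1 = 0 by exact: ball_sum_full.
have G0 : G 0%N = 0 by rewrite /G big_pred0.
have G1 : G 1%N = f x.
  by rewrite /G (big_pred1 x) // => y; rewrite ltnS leqn0 gdist_eq0 // eq_sym.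
(* The coefficient of [G r.+1] may have either sign; bounding it by its absolute value gives the
   inequality in the required direction. *)
have absG r : (mu - k%:R) * `|G r.+1| <= (cs r.+1)%:R * `|G r.+2|
    + (bs r)%:R * `|G r| - ((bs r)%:R + (cs r.+1)%:R) * `|G r.+1|.
  have {}GE : (mu - k%:R + (bs r)%:R + (cs r.+1)%:R) * G r.+1
     = (cs r.+1)%:R * G r.+2 + (bs r)%:R * G r.
    by have := GE r; lra.
  have := ler_normD ((cs r.+1)%:R * G r.+2) ((bs r)%:R * G r).
  rewrite -GE !normrM !normr_nat.
  have := ler_wpM2r (normr_ge0 (G r.+1)) (ler_norm (mu - k%:R + (bs r)%:R + (cs r.+1)%:R)).
  by lra.
pose S := \sum_(r < d) `|G r.+1| * D r.
(* The centre [x] was chosen with [f x != 0], so the term [r = 0] is positive. *)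
have S0 : 0 < S.
  rewrite /S -(prednK d0) big_ord_recl.
  rewrite ltr_pwDl ?mulr_gt0 ?normr_gt0 ?G1 //.
  by apply: sumr_ge0 => i _; rewrite mulr_ge0 // ltW.
suff : (mu - k%:R) * S <= (th - k%:R) * S by rewrite ler_pM2r // lerD2r.
pose X r := (cs r)%:R * D r.-1 * `|G r.+1|; pose Y r := (bs r)%:R * D r * `|G r|.
(* Summation by parts: the boundary terms vanish because [cs 0], [G d.+1], [G 0] and [bs d] are all
   zero. *)
have shift Z : Z 0%N = 0 -> Z d = 0 -> \sum_(r < d) Z r.+1 = \sum_(r < d) Z r :> R.
  move=> Z0 Zd; apply: (addrI (Z 0%N)); rewrite -(big_ord_recl d (fun r : 'I_d.+1 => Z r)).
  by rewrite big_ord_recr /= Z0 Zd add0r addr0.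
have XS : \sum_(r < d) X r.+1 = \sum_(r < d) X r.
  by apply: shift; rewrite /X ?c0 ?Gd ?normr0 ?mulr0 ?mul0r.
have YS : \sum_(r < d) Y r.+1 = \sum_(r < d) Y r.
  by apply: shift; rewrite /Y ?bd ?G0 ?normr0 ?mulr0 ?mul0r.
have -> : (th - k%:R) * S =
  \sum_(r < d) (X r.+1 + Y r - ((bs r)%:R + (cs r.+1)%:R) * D r * `|G r.+1|).
  rewrite sumrB big_split /= XS -YS -big_split /= -sumrB mulr_sumr; apply: eq_bigr => r _.
  by rewrite mulrCA -DE // /X /Y; ring.
rewrite /S mulr_sumr; apply: ler_sum => r _; rewrite /X /Y /=.
have := ler_wpM2r (ltW (D0 r)) (absG r); lra.
Qed.

End DistanceRegular.

(** * The second eigenvalue and its cosine sequence for classical parameters *)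

Section ClassicalParameters.
Variables (R : rcfType) (T : finType) (e : rel T).
Variables (d k : nat) (bs cs : nat -> nat) (b : int) (alpha beta : R).
Hypothesis d0 : (0 < d)%N.
Hypothesis hG : distance_regular e d k bs cs.
Hypothesis hcl : classical_parameters bs cs d b alpha beta.
Hypothesis hb : 1 <= b.

Let q : R := b%:~R.
Let br n : R := \sum_(j < n) q ^+ j.
Let S n : R := \sum_(j < n) q^-1 ^+ j.

Let q1 : 1 <= q. Proof. by rewrite /q -[1]/(1%:~R) ler_int. Qed.
Let q0 : 0 < q. Proof. exact: lt_le_trans q1. Qed.

(** The geometric sum covers [b = 1] and [b > 1] at once, so later computations need no case
    split. *)
Lemma gauss_1E (n : nat) : gauss R b n 1 = br n.
Proof.
rewrite /gauss /=; case: eqP => [b1|/eqP b1].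
  rewrite /binz bin1 /br /q b1; under eq_bigr do rewrite expr1n.
  by rewrite sumr_const card_ord.
rewrite big_ord1 /= !subr0 expr1z -exprnP subrX1 mulrC mulKf //.
by rewrite subr_eq0 -[1]/(1%:~R) eqr_int.
Qed.

Let brX n : q ^+ n = 1 + (q - 1) * br n.
Proof. by rewrite -subrX1; ring. Qed.

(** Multiplying by [q ^+ n] reverses the geometric sum; this expresses [S] through [br]. *)
Let qS n : q ^+ n * S n = q * br n.
Proof.
elim: n => [|n IH]; first by rewrite /S /br !big_ord0 !mulr0.
rewrite /S big_ord_recr /= -/(S n) mulrDr {1}exprS -mulrA IH exprVn exprS mulfK; last first.
  by rewrite expf_neq0 ?gt_eqF.
by rewrite /br big_ord_recr /= -/(br n) brX; ring.
Qed.

Definition theta1 : R := (bs 1)%:R / q - 1.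

Let kR : R := k%:R.
Let s : R := 1 - theta1 / kR.

Let k0 : 0 < kR. Proof. by rewrite ltr0n (valency_gt0 hG). Qed.

Let bE r : (r <= d)%N -> (bs r)%:R = (br d - br r) * (beta - alpha * br r).
Proof. by case/hcl => ->; rewrite !gauss_1E. Qed.

(** The factor [q] removes the division in [[r-1] = ([r] - 1) / q]. At [r = 0] the coefficient with
    upper index -1 is killed by [[0] = 0]. *)
Let cE r : (r <= d)%N -> q * (cs r)%:R = br r * (q + alpha * (br r - 1)).
Proof.
case/hcl => _ ->; rewrite gauss_1E; case: r => [|r].
  by rewrite /br big_ord0 !mul0r mulr0.
rewrite -addn1 PoszD addrK gauss_1E addn1 /br big_ord_recr /= -/(br r) brX; ring.
Qed.

Let b_d : bs d = 0%N.
Proof. by apply/eqP; rewrite -(eqr_nat R) bE // subrr mul0r. Qed.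

Let c_0 : cs 0 = 0%N.
Proof.
apply/eqP; rewrite -(eqr_nat R) -(mulrI_eq0 _ (mulfI (lt0r_neq0 q0))).
by rewrite cE // /br big_ord0 mul0r.
Qed.

Lemma theta1_lt_valency : theta1 < kR.
Proof.
have : (bs 1)%:R / q <= (bs 1)%:R by rewrite ler_pdivrMr // ler_peMr.
have : (bs 1)%:R <= kR by rewrite ler_nat (b_le_valency hG).
by rewrite /theta1; lra.
Qed.

Let s0 : 0 < s.
Proof. by rewrite subr_gt0 ltr_pdivrMr // mul1r theta1_lt_valency. Qed.

Let D r : R := s * q^-1 ^+ r.
Let D0 r : 0 < D r. Proof. by rewrite mulr_gt0 // exprn_gt0 // invr_gt0. Qed.

Definition cosine1 (r : nat) : R := 1 - s * S r.

Let cosine1S r : cosine1 r.+1 = cosine1 r - D r.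
Proof. by rewrite /cosine1 /S big_ord_recr /= /D; ring. Qed.

(** This is the three-term recurrence in terms of the differences [D r] of consecutive cosines. The
    junk value [D 0.-1] at [r = 0] is multiplied by [cs 0 = 0]. *)
Let cosine1_eq r : (r <= d)%N ->
  (kR - theta1) * cosine1 r = (bs r)%:R * D r - (cs r)%:R * D r.-1.
Proof.
move=> rd; have qr0 : q ^+ r != 0 by rewrite expf_neq0 ?gt_eqF.
have cD : (cs r)%:R * D r.-1 = q * (cs r)%:R * D r.
  case: r {rd qr0} => [|r]; first by rewrite c_0 mulr0 !mul0r.
  rewrite /D /= exprS; field; by rewrite gt_eqF.
rewrite cD -mulrBl cE // bE //.
have sk : s * kR = kR - theta1 by rewrite /s mulrBl mul1r divfK ?gt_eqF.
have kE : kR = br d * beta.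
  by rewrite /kR -(b_0 hG) // bE // /br big_ord0 !subr0 mulr0 subr0.
have thE : q * theta1 = (br d - 1) * (beta - alpha) - q.
  rewrite /theta1 bE // [br 1]big_ord1 expr0; field; by rewrite gt_eqF.
(* Cancelling [s * q^-1 ^+ r] leaves an identity that becomes polynomial in [br r] and [br d],
   through [qS] and [brX]. *)
suff <- : q ^+ r * (kR * cosine1 r) =
    (br d - br r) * (beta - alpha * br r) - br r * (q + alpha * (br r - 1)).
  by rewrite -sk /D exprVn; field.
have -> : q ^+ r * (kR * cosine1 r) = kR * q ^+ r - s * kR * (q ^+ r * S r).
  by rewrite /cosine1; ring.
rewrite qS sk.
have -> : (kR - theta1) * (q * br r) = (q * kR - q * theta1) * br r by ring.
by rewrite thE brX kE; ring.
Qed.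

Lemma theta1_eigenvalue : eigenvalue (adjacency_mx e R) theta1.
Proof.
apply: (eigenvalue_radial (phi := cosine1) hG d0).
  by rewrite /cosine1 /S big_ord0 mulr0 subr0 oner_neq0.
move=> r rd; have := cosine1_eq rd; rewrite cosine1S; case: r {rd} => [|r] /=.
  by rewrite c_0; lra.
by rewrite cosine1S; lra.
Qed.

Lemma eigenvalue_le_theta1 (mu : R) :
  eigenvalue (adjacency_mx e R) mu -> mu != kR -> mu <= theta1.
Proof.
apply: (eigenvalue_le hG d0 D0 b_d c_0) => r rd.
(* Subtracting the recurrences at [r] and [r + 1] gives the eigenvector equation for [D]. *)
have := cosine1_eq rd; have := cosine1_eq (ltnW rd); rewrite cosine1S /=.
by rewrite -/kR; lra.
Qed.

Lemma second_eigenvalue (theta : seq R) : eigenvalue_list e theta ->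
  theta`_1 = theta1.
Proof.
case=> srt mem_theta; apply: (second_of_sorted (x := kR)) => //.
- by rewrite mem_theta; apply: eigenvalue_valency hG d0.
- by rewrite mem_theta theta1_eigenvalue.
- exact: theta1_lt_valency.
- by move=> z; rewrite mem_theta; exact: eigenvalue_le_theta1.
Qed.

Lemma cosine_sequence_theta1 (w : nat -> R) :
    cosine_sequence d k bs cs theta1 w ->
  forall r, (r <= d)%N -> w r = cosine1 r.
Proof.
case=> w0 w1 wE.
have phi0 : cosine1 0 = 1 by rewrite /cosine1 /S big_ord0 mulr0 subr0.
have phi1 : cosine1 1 = theta1 / kR.
  by rewrite cosine1S phi0 /D expr0 mulr1 /s; ring.
(* The recurrence has order two, so the induction carries two consecutive values; [bs r.+1 > 0] lets
   it be solved for the next one. *)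
suff H r : ((r <= d)%N -> w r = cosine1 r) /\ ((r < d)%N -> w r.+1 = cosine1 r.+1).
  by move=> r; case: (H r).
elim: r => [|r [IH0 IH1]]; first by rewrite w0 w1 phi0 phi1.
split=> // rd; have := wE r.+1 rd; have := cosine1_eq (ltnW rd).
rewrite /= IH0 ?IH1 //; [|lia|lia].
have b_pos : 0 < (bs r.+1)%:R :> R by rewrite ltr0n (b_gt0 hG).
rewrite -/kR => E1 E2; apply: (mulfI (lt0r_neq0 b_pos)); rewrite cosine1S.
have DrE : D r = cosine1 r - cosine1 r.+1 by rewrite cosine1S; ring.
by rewrite DrE in E1; lra.
Qed.

Lemma one_sub_cosine1_le (r : nat) : (0 < r <= d)%N ->
  (1 - cosine1 d) / d%:R ^+ 2 <= (1 - cosine1 r) / r%:R ^+ 2.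
Proof.
move=> rd; rewrite /cosine1 !subKr -!mulrA ler_pM2l //.
by apply: geometric_sum_div_sqr => //; rewrite ?invr_gt0 ?invf_le1.
Qed.

End ClassicalParameters.

(** * The minimum is attained at the diameter *)

Theorem theorem5p1 (R : rcfType) (T : finType) (e : rel T)
    (d k : nat) (bs cs : nat -> nat) (b : int) (alpha beta : R)
    (theta : seq R) (w : nat -> R)
    (hd : (0 < d)%N)
    (hG : distance_regular e d k bs cs)
    (hcl : classical_parameters bs cs d b alpha beta)
    (hb : 1 <= b)
    (htheta : eigenvalue_list e theta)
    (hw : cosine_sequence d k bs cs theta`_1 w) :
  min_range 1 d (fun r => (1 - w r) / r%:R ^+ 2) = (1 - w d) / d%:R ^+ 2.
Proof.
rewrite (second_eigenvalue hd hG hcl hb htheta) in hw.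
have wE := cosine_sequence_theta1 hd hG hcl hb hw.
have le_F r : (0 < r <= d)%N -> (1 - w d) / d%:R ^+ 2 <= (1 - w r) / r%:R ^+ 2.
  move=> rd; rewrite !wE //; last by case/andP: rd.
  exact: (one_sub_cosine1_le R hd hG hb rd).
apply/eqP; rewrite eq_le; apply/andP; split.
  by apply: ge_bigmin_seq; rewrite // mem_index_iota hd ltnSn.
(* The default of the minimum is the value at 1, which satisfies the same bound since [1 <= d]. *)
rewrite /min_range big_seq; apply: le_bigmin; first by apply: le_F; lia.
by move=> r; rewrite mem_index_iota ltnS; exact: le_F.
Qed.
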